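(* Let $\mathcal H$ be a Hilbert space with orthonormal basis $e_H=(e_{H;j})_{j\in D}$, $D$ at most countable, $\mathcal B=\mathcal B(\mathcal H)$, and $e_{H;jj}$ the rank-one projection onto $\mathbb C e_{H;j}$. Let $\varphi$ be the quantum Markov chain on $\mathcal A=\bigotimes_{\mathbb N}\mathcal B$ determined by the pair $(\varphi_0,\mathcal E)$, where $$\varphi_0=\mathrm{Tr}(w_0\,\cdot\,),\quad w_0=\sum_{j\in D}p^{(0)}_{H;j}e_{H;jj}\ \text{ a density operator with non-degenerate spectrum},$$ $$\mathcal E(x)=\overline{\mathrm{Tr}}_2(K^*xK),\quad K=\sum_{j,k\in D}\sqrt{p_{H;jk}}\;e_{H;jj}\otimes e_{H;kk},$$ $P_H=(p_{H;jk})$ being a stochastic matrix and $\sqrt{p_{H;jk}}$ an arbitrary (complex) square root of $p_{H;jk}$. For each $n\in\mathbb N$ let $e_{O_n}=(e_{O_n;j})_{j\in D}$ be an orthonormal basis of $\mathcal H$ and $e_{O_n;jj}$ the projection onto $\mathbb Ce_{O_n;j}$. Then the restriction of $\varphi$ to the $e_O$-diagonal algebra $\mathcal D_{(e_O)}=\bigotimes_{n\in\mathbb N}\mathcal D_{e_{O_n}}$ is characterized by the joint probabilities $$\varphi\bigl(j_0(e_{O_0;k_0k_0})j_1(e_{O_1;k_1k_1})\cdots j_n(e_{O_n;k_nk_n})\bigr)=\sum_{j_0,\dots,j_n\in D}p^{(0)}_{H;j_0}p_{H;j_0j_1}\cdots p_{H;j_{n-1}j_n}\prod_{m=0}^np(O_m=k_m\mid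 H_m=j_m)$$ for all $n\in\mathbb N$, $k_0,\dots,k_n\in D$, where $$p(O_m=k\mid H_m=j)=|\langle e_{H;j},e_{O_m;k}\rangle|^2.$$
   Context: Tensor products of algebras are algebraic; $j_n:\mathcal B\to\mathcal A$ is the embedding in the $n$-th factor. $\overline{\mathrm{Tr}}_2$ is the partial trace over the second factor, $\overline{\mathrm{Tr}}_2(a\otimes b)=a\,\mathrm{Tr}(b)$. If $D$ is infinite, $K$ is the bounded operator on $\mathcal H\otimes\mathcal H$ given by the strongly convergent sum. A stochastic matrix has nonnegative entries with $\sum_kp_{jk}=1$ for each $j$. The quantum Markov chain determined by $(\varphi_0,\mathcal E)$ is the state with $$\varphi(j_0(a_0)j_1(a_1)\cdots j_n(a_n))=\varphi_0(\mathcal E(a_0\otimes\mathcal E(a_1\otimes\cdots\otimes\mathcal E(a_{n-1}\otimes\mathcal E(a_n\otimes1))\cdots))).$$ $\mathcal D_{e_{O_n}}$ is the linear span of $\{e_{O_n;jj}:j\in D\}$ in the $n$-th factor. *)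

(* Defs.v *)
From HB Require Import structures.
From mathcomp Require Import all_boot all_order all_algebra finmap complex.
From mathcomp Require Import all_classical all_reals all_analysis.
From mathcomp Require Import summability ring.

Set Implicit Arguments.
Unset Strict Implicit.
Unset Printing Implicit Defensive.

Import Order.TTheory GRing.Theory Num.Theory.
Import numFieldNormedType.Exports.

Local Open Scope classical_set_scope.
Local Open Scope ring_scope.
Local Open Scope complex_scope.

(* Unconditional summation: convergence of the net of finite partial sums. *)
Definition has_sum (K : numFieldType) (V : normedModType K) (I : choiceType)
    (x : I -> V) (s : V) : Prop :=
  partial_sum x @ totally --> s.

(* The inner product is linear in its first argument and conjugate-linear in
   the second one. *)
Record hilbert (R : realType) := Hilbert {
  hspace :> completeNormedModType R[i];
  inner : {dot hspace for Num.conj};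
  inner_norm : forall u, inner u u = `|u| ^+ 2 }.

Arguments inner {R h}.

Lemma inner_le (R : realType) (H : hilbert R) (u v : H) :
  `|inner u v| <= `|u| * `|v|.
Proof.
have [->|v0] := eqVneq v 0; first by rewrite linear0r !normr0 mulr0.
have nv : 0 < `|v| by rewrite normr_gt0.
have E (x y : H) : inner y x = (inner x y)^*%R.
  by rewrite (hermC inner) /= expr0 mul1r.
have El k (x y z : H) : inner (k *: x + y) z = k * inner x z + inner y z.
  by rewrite linearPl.
have Er k (x y z : H) : inner z (k *: x + y) = k^*%R * inner z x + inner z y.
  by rewrite E El rmorphD rmorphM /= -!E.
set c := inner u v.
have := inner_norm ((- c) *: v + (`|v| ^+ 2 *: u + 0)).
rewrite !(El, Er) !linear0l !linear0r !inner_norm (E u v) -/c.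
have -> : (`|v| ^+ 2)^*%R = `|v| ^+ 2.
  by apply/CrealP; rewrite rpredX // normr_real.
rewrite rmorphN /=; set w := `|_ + _|; move=> Ew.
have {Ew} : 0 <= `|v| ^+ 2 * (`|v| ^+ 2 * `|u| ^+ 2 - c * c^*%R).
  rewrite (_ : _ * _ = w ^+ 2) ?exprn_ge0 ?normr_ge0 // -Ew; ring.
rewrite pmulr_rge0 ?exprn_gt0 // subr_ge0 -normCK -exprMn mulrC.
by rewrite ler_pXn2r // nnegrE ?mulr_ge0.
Qed.

(* B(H), with composition as product; for linear maps, continuity is
   boundedness. *)
Record bop (R : realType) (H : hilbert R) := Bop {
  bop_fun :> H -> H;
  bop_linear : linear bop_fun;
  bop_continuous : continuous bop_fun }.

Section BopAlgebra.
Variables (R : realType) (H : hilbert R).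
Implicit Types a b c : bop H.

Lemma bopP a b : (a : H -> H) =1 b -> a = b.
Proof.
case: a b => [f fl fc] [g gl gc] /= /funext fg; subst g.
by congr Bop; exact: Prop_irrelevance.
Qed.

HB.instance Definition _ := gen_eqMixin (bop H).
HB.instance Definition _ := gen_choiceMixin (bop H).

Program Definition bop0 : bop H := @Bop R H (fun=> 0) _ _.
Next Obligation. by move=> k u v; rewrite scaler0 addr0. Qed.
Next Obligation. by move=> u; exact: cvg_cst. Qed.

Program Definition bopN a : bop H := @Bop R H (fun u => - a u) _ _.
Next Obligation. by move=> a k u v; rewrite bop_linear opprD scalerN. Qed.
Next Obligation. by move=> a u; apply: cvgN; exact: bop_continuous. Qed.

Program Definition bopD a b : bop H := @Bop R H (fun u => a u + b u) _ _.
Next Obligation.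
by move=> a b k u v; rewrite !bop_linear scalerDr addrACA.
Qed.
Next Obligation. by move=> a b u; apply: cvgD; exact: bop_continuous. Qed.

Program Definition bopZ (k : R[i]) a : bop H := @Bop R H (fun u => k *: a u) _ _.
Next Obligation.
by move=> k a l u v; rewrite bop_linear scalerDr !scalerA mulrC.
Qed.
Next Obligation. by move=> k a u; apply: cvgZr; exact: bop_continuous. Qed.

Program Definition bop1 : bop H := @Bop R H id _ _.
Next Obligation. by []. Qed.
Next Obligation. by move=> u; exact: cvg_id. Qed.

Program Definition bopM a b : bop H := @Bop R H (a \o b) _ _.
Next Obligation. by move=> a b k u v /=; rewrite !bop_linear. Qed.
Next Obligation.
by move=> a b u; apply: continuous_comp; exact: bop_continuous.
Qed.

Lemma bopDE a u v : a (u + v) = a u + a v.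
Proof. by have := bop_linear a 1 u v; rewrite !scale1r. Qed.

Lemma bop0E a : a 0 = 0.
Proof. by apply: (addIr (a 0)); rewrite -bopDE !add0r. Qed.

Lemma bopZE a k u : a (k *: u) = k *: a u.
Proof. by have := bop_linear a k u 0; rewrite bop0E !addr0. Qed.

Fact bopDA : associative bopD.
Proof. by move=> a b c; apply: bopP => u; exact: addrA. Qed.
Fact bopDC : commutative bopD.
Proof. by move=> a b; apply: bopP => u; exact: addrC. Qed.
Fact bopD0 : left_id bop0 bopD.
Proof. by move=> a; apply: bopP => u; exact: add0r. Qed.
Fact bopDN : left_inverse bop0 bopN bopD.
Proof. by move=> a; apply: bopP => u; exact: addNr. Qed.
HB.instance Definition _ :=
  GRing.isZmodule.Build (bop H) bopDA bopDC bopD0 bopDN.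

Fact bopMA : associative bopM.
Proof. by move=> a b c; exact: bopP. Qed.
Fact bopM1l : left_id bop1 bopM.
Proof. by move=> a; exact: bopP. Qed.
Fact bopM1r : right_id bop1 bopM.
Proof. by move=> a; exact: bopP. Qed.
Fact bopMDl : left_distributive bopM +%R.
Proof. by move=> a b c; exact: bopP. Qed.
Fact bopMDr : right_distributive bopM +%R.
Proof. by move=> a b c; apply: bopP => u; exact: bopDE. Qed.
HB.instance Definition _ :=
  GRing.Zmodule_isPzRing.Build (bop H) bopMA bopM1l bopM1r bopMDl bopMDr.

Fact bopZA k l a : bopZ k (bopZ l a) = bopZ (k * l) a.
Proof. by apply: bopP => u; exact: scalerA. Qed.
Fact bopZ1 : left_id 1 bopZ.
Proof. by move=> a; apply: bopP => u; exact: scale1r. Qed.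
Fact bopZDr : right_distributive bopZ +%R.
Proof. by move=> k a b; apply: bopP => u; exact: scalerDr. Qed.
Fact bopZDl a : {morph bopZ^~ a : k l / k + l}.
Proof. by move=> k l; apply: bopP => u; exact: scalerDl. Qed.
HB.instance Definition _ :=
  GRing.Zmodule_isLmodule.Build R[i] (bop H) bopZA bopZ1 bopZDr bopZDl.

End BopAlgebra.

(* For a unit vector e this is the orthogonal projection onto its span. *)
Program Definition rank_one (R : realType) (H : hilbert R) (e : H) : bop H :=
  @Bop R H (fun u => inner u e *: e) _ _.
Next Obligation.
by move=> R H e k u v; rewrite linearDl linearZl_LR /= scalerDl scalerA.
Qed.
Next Obligation.
move=> R H e u; apply/cvgrPdist_lt => eps eps0.
near=> v; rewrite -scalerBl -linearBl normrZ.
rewrite (le_lt_trans (ler_wpM2r (normr_ge0 _) (inner_le _ _))) // -mulrA.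
rewrite (@le_lt_trans _ _ (`|u - v| * (`|e| * `|e| + 1))) //.
  by rewrite ler_wpM2l // lerDl.
rewrite -ltr_pdivlMr ?ltr_wpDl ?mulr_ge0 //.
near: v; apply: cvgr_dist_lt; first exact: cvg_id.
by rewrite divr_gt0 // ltr_wpDl ?mulr_ge0.
Unshelve. all: by end_near. Qed.

Definition lin_span (K : pzRingType) (V : lmodType K) (S : set V) : set V :=
  [set x | exists n (c : 'I_n -> K) (v : 'I_n -> V),
     (forall i, S (v i)) /\ x = \sum_(i < n) c i *: v i].

Definition is_adjoint (R : realType) (H : hilbert R) (a b : bop H) : Prop :=
  forall u v, inner (a u) v = inner u (b v).

Definition orthonormal_basis (R : realType) (H : hilbert R) (I : choiceType)
    (f : I -> H) : Prop :=
  (forall i j, inner (f i) (f j) = (i == j)%:R) /\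
  (forall u, has_sum (fun i => inner u (f i) *: f i) u).

(* "b is trace class and Tr b = t": an operator whose diagonal matrix elements
   are unconditionally summable in every orthonormal basis is trace class. *)
Definition is_trace (R : realType) (H : hilbert R) (b : bop H) (t : R[i]) :
    Prop :=
  forall (I : choiceType) (f : I -> H), orthonormal_basis f ->
    has_sum (fun i => inner (b (f i)) (f i) : R[i]^o) t.

Definition is_density (R : realType) (H : hilbert R) (w : bop H) : Prop :=
  (forall u, 0 <= inner (w u) u) /\ is_trace w 1.

Definition nondegenerate_spectrum (R : realType) (H : hilbert R) (w : bop H) :
    Prop :=
  forall (l : R[i]) (u v : H), u != 0 -> w u = l *: u -> w v = l *: v ->
    exists c : R[i], v = c *: u.

(* The Hilbert space tensor product, up to unitary equivalence, together with
   the operators a (x) b; the latter are determined by [top_tmul] and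
   [tmul_total]. *)
Record hilbert_tensor (R : realType) (H1 H2 : hilbert R) := HilbertTensor {
  tspace :> hilbert R;
  tmul : {bilinear H1 -> H2 -> tspace};
  inner_tmul : forall u u' v v',
    inner (tmul u v) (tmul u' v') = inner u u' * inner v v';
  tmul_total :
    closure (lin_span [set x | exists u v, x = tmul u v]) = [set: tspace];
  top : bop H1 -> bop H2 -> bop tspace;
  top_tmul : forall a b u v, top a b (tmul u v) = tmul (a u) (b v) }.
Arguments tmul {R H1 H2 h}.
Arguments top {R H1 H2 h}.

(* The partial trace over the second factor: T = (id (x) Tr)(y), defined
   through its matrix elements for those y for which the sums converge, with the
   same value, in every orthonormal basis of the second space.  On a (x) b it is
   a Tr(b), see [is_ptrace2_top]. *)
Definition is_ptrace2 (R : realType) (H1 H2 : hilbert R)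
    (HH : hilbert_tensor H1 H2) (y : bop HH) (T : bop H1) : Prop :=
  forall (I : choiceType) (f : I -> H2), orthonormal_basis f ->
    forall u v : H1,
      has_sum (fun i => inner (y (tmul u (f i))) (tmul v (f i)) : R[i]^o)
        (inner (T u) v).

Lemma is_ptrace2_top (R : realType) (H1 H2 : hilbert R)
    (HH : hilbert_tensor H1 H2) (a : bop H1) (b : bop H2) (t : R[i]) :
  is_trace b t -> is_ptrace2 (top a b : bop HH) (t *: a).
Proof.
move=> bt I f fb u v; have /(_ I f fb) := bt; rewrite /has_sum.
set x := fun i => _; set y := fun i => _; move=> xt.
have -> : partial_sum y = (fun J => inner (a u) v *: partial_sum x J).
  apply/funext => J; rewrite /partial_sum scaler_sumr; apply: eq_bigr => i _.
  by rewrite /y /x top_tmul inner_tmul.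
have -> : inner ((t *: a) u) v = (inner (a u) v *: (t : R[i]^o)).
  by rewrite linearZl_LR /= mulrC.
by apply: (cvgZl_tmp (FF := totally_filter)); exact: xt.
Qed.

Definition alg_morphism (R : realType) (H : hilbert R) (C : algType R[i])
    (f : bop H -> C) : Prop :=
  linear f /\ monoid_morphism f.

Definition commuting_ranges (B : Type) (C : pzRingType) (f : nat -> B -> C) :
    Prop :=
  forall m n, m <> n -> forall a b, f m a * f n b = f n b * f m a.

(* The algebraic tensor product of copies of B(H) indexed by nat, as a unital
   *-algebra: the universal one receiving commuting copies of B(H). *)
Record tensor_chain (R : realType) (H : hilbert R) := TensorChain {
  chain_alg :> algType R[i];
  star : chain_alg -> chain_alg;
  star_linear : forall k x y, star (k *: x + y) = k^*%R *: star x + star y;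
  starM : forall x y, star (x * y) = star y * star x;
  starK : involutive star;
  emb : nat -> bop H -> chain_alg;
  emb_morphism : forall n, alg_morphism (emb n);
  emb_comm : commuting_ranges emb;
  emb_star : forall n a b, is_adjoint a b -> emb n b = star (emb n a);
  emb_universal : forall (C : algType R[i]) (f : nat -> bop H -> C),
    (forall n, alg_morphism (f n)) -> commuting_ranges f ->
    exists! h : chain_alg -> C,
      [/\ linear h, monoid_morphism h & forall n a, h (emb n a) = f n a] }.
Arguments star {R H t}.
Arguments emb {R H t}.

Definition is_state (R : realType) (H : hilbert R) (A : tensor_chain H)
    (phi : A -> R[i]) : Prop :=
  [/\ scalar phi, phi 1 = 1 & forall x, 0 <= phi (star x * x)].

(* The right-hand side is phi0 (E (a 0 (x) E (a 1 (x) ... E (a n (x) 1)))). *)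
Definition is_qmc (R : realType) (H : hilbert R) (HH : hilbert_tensor H H)
    (A : tensor_chain H) (phi0 : bop H -> R[i]) (E : bop HH -> bop H)
    (phi : A -> R[i]) : Prop :=
  is_state phi /\
  forall (n : nat) (a : nat -> bop H),
    phi (\prod_(0 <= m < n.+1) emb m (a m)) =
    phi0 (foldr (fun m x => E (top (a m) x)) 1 (iota 0 n.+1)).

Definition stochastic (R : realType) (D : choiceType) (P : D -> D -> R) :
    Prop :=
  (forall j k, 0 <= P j k) /\ (forall j, has_sum (P j : D -> R^o) 1).

(* The diagonal algebra of an orthonormal basis, with no closure taken: for
   infinite D it does not contain the unit of B(H). *)
Definition diag_factor (R : realType) (H : hilbert R) (D : choiceType)
    (e : D -> H) : set (bop H) :=
  lin_span (range (fun j => rank_one (e j))).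

(* The algebraic tensor product of the diagonal algebras, inside the chain:
   spanned by the elementary tensors j_0(a 0) ... j_n(a n). *)
Definition diag_algebra (R : realType) (H : hilbert R) (D : choiceType)
    (A : tensor_chain H) (eO : nat -> D -> H) : set A :=
  lin_span [set x | exists (n : nat) (a : nat -> bop H),
    (forall m, (m <= n)%N -> diag_factor (eO m) (a m)) /\
    x = \prod_(0 <= m < n.+1) emb m (a m)].

(* The conditional probability p(O = k | H = j). *)
Definition emission (R : realType) (H : hilbert R) (D : choiceType)
    (eH e : D -> H) (j k : D) : R[i] :=
  `|inner (eH j) (e k)| ^+ 2.

Definition has_joint_probabilities (R : realType) (H : hilbert R)
    (D : choiceType) (A : tensor_chain H) (p0 : D -> R) (pH : D -> D -> R)
    (eH : D -> H) (eO : nat -> D -> H) (psi : A -> R[i]) : Prop :=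
  forall (n : nat) (k : nat -> D),
    has_sum (fun j : {ffun 'I_n.+1 -> D} =>
        ((p0 (j ord0) *
          \prod_(m < n) pH (j (widen_ord (leqnSn n) m)) (j (lift ord0 m)))%:C *
         \prod_(m < n.+1) emission eH (eO m) (j m) (k m)) : R[i]^o)
      (psi (\prod_(0 <= m < n.+1) emb m (rank_one (eO m (k m))))).

(* Main.v *)
(** In the basis [eH] everything is diagonal: [K] multiplies
    [eH j (x) eH k] by [s j k] and [w0] multiplies [eH j] by [p0 j].  Hence the
    diagonal entry of [E (a (x) b)] at [eH j] is
    [<a e_j, e_j> * \sum_k p_jk <b e_k, e_k>], and the diagonal entries alone of
    the nested expectation obey a backward recursion.  As
    [<rank_one e (eH j), eH j>] is the emission probability, unfolding the
    recursion gives an iterated sum of nonnegative terms, which Tonelli's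
    theorem turns into one sum over all hidden paths; stochasticity of [pH] is
    what ends the recursion, because the innermost argument of [E] is [a n (x) 1].
    The probabilities determine the restriction because the products of the
    projections [rank_one (eO m (k m))] span the diagonal algebra. *)

Require Import Defs.
From HB Require Import structures.
From mathcomp Require Import all_boot all_order all_algebra finmap complex.
From mathcomp Require Import all_classical all_reals all_analysis.
From mathcomp Require Import summability.

Import Order.TTheory GRing.Theory Num.Theory.
Import numFieldNormedType.Exports.

Local Open Scope classical_set_scope.
Local Open Scope ring_scope.
Local Open Scope complex_scope.

(** * Unconditional sums in normed spaces *)

Lemma has_sumP (K : numFieldType) (V : normedModType K) (I : choiceType)
    (x : I -> V) (s : V) :
  has_sum x s <-> forall eps : K, 0 < eps -> exists J0 : {fset I},
    forall J : {fset I}, fsubset J0 J -> `|s - \sum_(i <- J) x i| < eps.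
Proof.
rewrite /has_sum; split.
  move=> /(cvgrPdist_lt (FF := totally_filter)) h eps /h [J0 _ J0P].
  by exists J0 => J /J0P; rewrite /partial_sum /= big_seq_fsetE.
move=> h; apply/(cvgrPdist_lt (FF := totally_filter)) => eps /h [J0 J0P].
by exists J0 => // J /J0P; rewrite /partial_sum /= big_seq_fsetE.
Qed.

Lemma has_sum_unique (K : numFieldType) (V : normedModType K) (I : choiceType)
    (x : I -> V) (s t : V) : has_sum x s -> has_sum x t -> s = t.
Proof.
move=> xs xt.
exact: (cvg_unique (@norm_hausdorff _ V)
  (FF := fmap_proper_filter _ totally_filter) xs xt).
Qed.

Lemma eq_has_sum (K : numFieldType) (V : normedModType K) (I : choiceType)
    (x y : I -> V) (s : V) : x =1 y -> has_sum x s -> has_sum y s.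
Proof. by move=> /funext ->. Qed.

(** Evaluates the expansions of diagonal operators, where orthonormality leaves a single term. *)
Lemma has_sum_supp1 (K : numFieldType) (V : normedModType K) (I : choiceType)
    (i0 : I) (x : I -> V) :
  (forall i, i != i0 -> x i = 0) -> has_sum x (x i0).
Proof.
move=> x0; apply/has_sumP => eps eps0; exists [fset i0]%fset => J.
rewrite fsub1set => i0J; rewrite (big_fsetD1 i0) //= big1_fset.
  by rewrite addr0 subrr normr0.
by move=> i; rewrite in_fsetD1 => /andP[/x0 ->].
Qed.

Lemma has_sum_bij (K : numFieldType) (V : normedModType K) (I J : choiceType)
    (f : J -> I) (x : I -> V) (s : V) :
  bijective f -> has_sum x s -> has_sum (x \o f) s.
Proof.
move=> [g fK gK] /has_sumP xs; apply/has_sumP => eps /xs[A AP].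
exists [fset g i | i in A]%fset => B AB.
have := AP [fset f j | j in B]%fset; rewrite big_imfset /=; last first.
  by move=> i j _ _ /(can_inj fK).
apply; apply/fsubsetP => i iA; rewrite -(gK i); apply: in_imfset.
by apply: (fsubsetP AB); apply: in_imfset.
Qed.

Lemma has_sum_bop (R : realType) (H : hilbert R) (b : bop H) (I : choiceType)
    (x : I -> H) (s : H) : has_sum x s -> has_sum (b \o x) (b s).
Proof.
move=> xs; rewrite /has_sum.
have -> : partial_sum (b \o x) = b \o partial_sum x.
  apply/funext => J.
  by rewrite /partial_sum /= (big_morph b (bopDE b) (bop0E b)).
exact: (cvg_comp _ _ xs (@bop_continuous _ _ b s)).
Qed.

(** * Sums of nonnegative terms and Tonelli's theorem *)

Section NonnegativeSums.
Variable K : numFieldType.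

(* [K] may be only partially ordered, as [R[i]] is, so nonnegativity is
   obtained as [z = `|z|]. *)
Lemma ge0_limit (z : K) :
  (forall eps : K, 0 < eps -> exists2 w : K, 0 <= w & `|z - w| < eps) -> 0 <= z.
Proof.
move=> h; suff -> : z = `|z| by [].
apply/eqP; rewrite -subr_eq0 -normr_le0; apply/negP => /negP nz.
have z0 : 0 < `|z - `|z| | by rewrite normr_gt0 -normr_le0.
(* Since [w] equals its own modulus, both legs of the path from [z] through [w] to the modulus of
   [z] are shorter than half the distance. *)
have [w w0 zw] := h _ (divr_gt0 z0 (ltr0Sn K 1)).
suff : `|z - `|z| | < `|z - `|z| | by rewrite ltxx.
apply: (@le_lt_trans _ _ (`|z - w| + `|w - `|z| |)).
  by rewrite -{1}(subrKA w z (- `|z|)) ler_normD.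
rewrite [ltRHS]splitr ltrD // (le_lt_trans _ zw) //.
by have := ler_dist_dist w z; rewrite (ger0_norm w0) (distrC w z).
Qed.

Lemma ler_sum_fset (I : choiceType) (x : I -> K) (A B : {fset I}) :
  (forall i, 0 <= x i) -> fsubset A B -> \sum_(i <- A) x i <= \sum_(i <- B) x i.
Proof.
move=> x0 AB; rewrite [leRHS](big_fsetID _ (mem A)) /=.
rewrite (_ : [fset i in B | i \in A]%fset = A).
  by rewrite lerDl sumr_ge0.
apply/fsetP => i; rewrite !inE andbC; case: (boolP (i \in A)) => //= iA.
exact: (fsubsetP AB).
Qed.

(** Partial sums of nonnegative terms increase with the index set, so convergence splits into two
    one-sided conditions. This turns Tonelli's theorem into inequalities between finite sums. *)
Lemma ge0_has_sumP (I : choiceType) (x : I -> K) (s : K) :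
  (forall i, 0 <= x i) ->
  has_sum (x : I -> K^o) s <->
  (forall A : {fset I}, \sum_(i <- A) x i <= s) /\
  (forall eps : K, 0 < eps -> exists A : {fset I}, s - \sum_(i <- A) x i < eps).
Proof.
move=> x0; split=> [/has_sumP xs|[ub ap]].
  have ub (A : {fset I}) : \sum_(i <- A) x i <= s.
    rewrite -subr_ge0; apply: ge0_limit => eps /xs[B BP].
    (* This difference is within [eps] of [s - \sum_(i <- A) x i] because the union contains [B]. *)
    exists (\sum_(i <- (A `|` B)%fset) x i - \sum_(i <- A) x i).
      by rewrite subr_ge0 ler_sum_fset // fsubsetUl.
    by rewrite opprB addrA subrK BP // fsubsetUr.
  split=> // eps /xs[B /(_ B (fsubset_refl _))]; rewrite ger0_norm ?subr_ge0 //.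
  by exists B.
apply/has_sumP => eps /ap[A AP]; exists A => B AB.
rewrite ger0_norm ?subr_ge0 // (le_lt_trans _ AP) // lerB //.
exact: ler_sum_fset.
Qed.

Lemma sum_fsetM (I J : choiceType) (y : I * J -> K) (A : {fset I})
    (B : {fset J}) :
  \sum_(ij <- (A `*` B)%fset) y ij = \sum_(i <- A) \sum_(j <- B) y (i, j).
Proof.
rewrite -(big_allpairs (F := y)); apply/perm_big/uniq_perm => //.
  by apply: allpairs_uniq => // -[? ?] [? ?].
move=> [i j]; rewrite in_fsetM /=; apply/andP/allpairsP => /=.
  by move=> [iA jB]; exists (i, j).
by move=> [[i' j'] /= [? ? [-> ->]]].
Qed.

(** A finite set of pairs lies in the rectangle of its projections, which bounds its sum by [s].
    Conversely, half of [eps] is spent on choosing finitely many rows and the other half on cutting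
    these rows to finite pieces. *)
Lemma has_sum_tonelli (I J : choiceType) (y : I * J -> K) (g : I -> K) (s : K) :
  (forall ij, 0 <= y ij) ->
  (forall i, has_sum ((fun j => y (i, j)) : J -> K^o) (g i)) ->
  has_sum (g : I -> K^o) s -> has_sum (y : I * J -> K^o) s.
Proof.
move=> y0 yg gs.
have {}yg i := (ge0_has_sumP _ _ (g i) (fun j => y0 (i, j))).1 (yg i).
have g0 i : 0 <= g i.
  by have [/(_ fset0)] := yg i; rewrite big_seq_fset0.
have [gub gap] := (ge0_has_sumP _ _ s g0).1 gs.
apply/(ge0_has_sumP _ _ s y0); split.
  move=> C; set A := [fset ij.1 | ij in C]%fset.
  set B := [fset ij.2 | ij in C]%fset.
  apply: (@le_trans _ _ (\sum_(ij <- (A `*` B)%fset) y ij)).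
    apply: ler_sum_fset => //; apply/fsubsetP => ij ijC.
    by rewrite in_fsetM !in_imfset.
  rewrite sum_fsetM (le_trans _ (gub A)) // ler_sum // => i _.
  by have [->] := yg i.
move=> eps eps0; have [A AP] := gap _ (divr_gt0 eps0 (ltr0Sn K 1)).
(* Each row of [A] may lose an equal share of [eps / 2]; the successor keeps the divisor nonzero
   when [A] is empty. *)
have d0 : 0 < eps / 2 / #|` A|.+1%:R by rewrite !divr_gt0.
have /choice[B BP] i : exists B : {fset J},
    g i - \sum_(j <- B) y (i, j) < eps / 2 / #|` A|.+1%:R.
  by have [_ /(_ _ d0)] := yg i.
set C := (\bigcup_(i <- A) B i)%fset; exists (A `*` C)%fset.
rewrite sum_fsetM [ltRHS]splitr.
rewrite -(subrKA (\sum_(i <- A) g i)) ltr_leD // -sumrB.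
apply: (@le_trans _ _ (\sum_(i <- A) eps / 2 / #|` A|.+1%:R)).
  rewrite !big_seq ler_sum // => i iA; rewrite (le_trans _ (ltW (BP i))) //.
  rewrite lerB // ler_sum_fset // /C; exact: bigfcup_sup.
rewrite big_const_seq count_predT iter_addr_0.
rewrite -[leLHS]mulr_natr -[leLHS]mulrA ler_piMr //.
  by rewrite divr_ge0 // ltW.
by rewrite mulrC ler_pdivrMr // mul1r ler_nat.
Qed.

End NonnegativeSums.

Lemma has_sumZ (K : numFieldType) (I : choiceType) (c : K) (x : I -> K)
    (s : K) :
  has_sum (x : I -> K^o) s -> has_sum ((fun i => c * x i) : I -> K^o) (c * s).
Proof.
move=> xs; rewrite /has_sum.
have -> : partial_sum ((fun i => c * x i) : I -> K^o) =
    (fun A => c *: (partial_sum (x : I -> K^o) A)).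
  by apply/funext => A; rewrite /partial_sum scaler_sumr.
by apply: (cvgZl_tmp (FF := totally_filter)); exact: xs.
Qed.

Lemma has_sum_real_complex (R : realType) (I : choiceType) (x : I -> R)
    (s : R) :
  has_sum (x : I -> R^o) s -> has_sum ((fun i => (x i)%:C) : I -> R[i]^o) s%:C.
Proof.
move=> /has_sumP xs; apply/has_sumP => -[eps eps'].
(* Positivity in [R[i]] forces the imaginary part of the tolerance to vanish, leaving a real
   tolerance for the given sum. *)
rewrite ltcE /= => /andP[/eqP -> /xs[A AP]].
exists A => B /AP; rewrite -rmorph_sum -rmorphB /= normc_def /=.
by rewrite expr0n addr0 sqrtr_sqr ltcR.
Qed.

(** * Hidden paths and the backward recursion *)

Definition ffun_uncons (D : Type) (n : nat) (f : {ffun 'I_n.+1 -> D}) :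
    D * {ffun 'I_n -> D} :=
  (f ord0, [ffun i => f (lift ord0 i)]).
Arguments ffun_uncons {D n}.

Lemma ffun_uncons_bij (D : Type) (n : nat) : bijective (@ffun_uncons D n).
Proof.
exists (fun jg : D * {ffun 'I_n -> D} =>
  [ffun i : 'I_n.+1 => if unlift ord0 i is Some i' then jg.2 i' else jg.1]).
  move=> f; apply/ffunP => i; rewrite ffunE.
  by case: unliftP => [j ->|->] //=; rewrite ffunE.
move=> [j g]; rewrite /ffun_uncons !ffunE unlift_none; congr pair.
by apply/ffunP => i; rewrite !ffunE liftK.
Qed.

(** The initial distribution is left out, so that an induction on path length can replace it by any
    nonnegative weight. *)
Definition path_weight (K : pzRingType) (D : Type) (p : D -> D -> K)
    (e : nat -> D -> K) (n : nat) (f : {ffun 'I_n.+1 -> D}) : K :=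
  \prod_(m < n) p (f (widen_ord (leqnSn n) m)) (f (lift ord0 m)) *
  \prod_(m < n.+1) e m (f m).
Arguments path_weight {K D} p e {n}.

Lemma path_weightS (K : comPzRingType) (D : Type) (p : D -> D -> K)
    (e : nat -> D -> K) (n : nat) (f : {ffun 'I_n.+2 -> D}) :
  let g := (ffun_uncons f).2 in
  path_weight p e f =
  e 0%N (f ord0) * p (f ord0) (g ord0) * path_weight p (fun m => e m.+1) g.
Proof.
rewrite /path_weight /= [in LHS]big_ord_recl [X in _ * X = _]big_ord_recl /=.
rewrite !ffunE (_ : widen_ord _ _ = ord0); last exact: val_inj.
rewrite mulrACA [p _ _ * _]mulrC; congr (_ * (_ * _)).
  apply: eq_bigr => i _; rewrite !ffunE; congr (p (f _) (f _)).
  exact: val_inj.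
by apply: eq_bigr => i _; rewrite !ffunE.
Qed.

(** [t m j] is the total weight of the emissions from time [m] on, given hidden state [j] at time
    [m]. For a fixed first state the induction hypothesis sums over the remaining paths, and
    Tonelli's theorem then sums over the first state. *)
Lemma has_sum_path_weight (K : numFieldType) (D : choiceType) (p : D -> D -> K)
    (n : nat) (e t : nat -> D -> K) (q : D -> K) (s : K) :
  (forall j k, 0 <= p j k) -> (forall m j, 0 <= e m j) ->
  (forall j, 0 <= q j) ->
  (forall m j, (m < n)%N ->
    has_sum ((fun k => e m j * p j k * t m.+1 k) : D -> K^o) (t m j)) ->
  t n =1 e n ->
  has_sum ((fun j => q j * t 0%N j) : D -> K^o) s ->
  has_sum ((fun f => q (f ord0) * path_weight p e f) :
    {ffun 'I_n.+1 -> D} -> K^o) s.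
Proof.
move=> p0; elim: n e t q s => [|n IHn] e t q s e0 q0 tS tn qs.
  have fstb : bijective (fun f : {ffun 'I_1 -> D} => f ord0).
    exists (fun j => [ffun=> j]) => [f|j]; last by rewrite ffunE.
    by apply/ffunP => i; rewrite ffunE (ord1 i).
  apply: eq_has_sum (has_sum_bij _ _ _ _ _ _ _ fstb qs) => f /=.
  by rewrite /path_weight big_ord0 big_ord1 mul1r tn.
set y := fun jg : D * {ffun 'I_n.+1 -> D} => q jg.1 *
  (e 0%N jg.1 * p jg.1 (jg.2 ord0) * path_weight p (fun m => e m.+1) jg.2).
have ys : has_sum (y : _ -> K^o) s.
  apply: has_sum_tonelli qs => [jg|j].
    by rewrite !mulr_ge0 // prodr_ge0.
  (* With the first state [j] fixed, the tail starting at [k] has initial weight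
     [q j * (e 0 j * p j k)], and the recursion for [t] gives the total [q j * t 0 j]. *)
  have := IHn (fun m => e m.+1) (fun m => t m.+1)
    (fun k => q j * (e 0%N j * p j k)) (q j * t 0%N j).
  move=> /(_ (fun m => e0 m.+1)) H; apply: eq_has_sum (H _ _ _ _).
  - by move=> g; rewrite /y /= !mulrA.
  - by move=> k; rewrite !mulr_ge0.
  - by move=> m k mn; exact: tS.
  - exact: tn.
  - apply: eq_has_sum (has_sumZ _ _ (q j) _ _ (tS 0%N j isT)) => k.
    by rewrite !mulrA.
apply: eq_has_sum (has_sum_bij _ _ _ _ _ _ _ (ffun_uncons_bij D n.+1) ys) => f.
by rewrite path_weightS.
Qed.

(** * Operators diagonal in the hidden basis *)

Lemma inner_conj (R : realType) (H : hilbert R) (u v : H) :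
  inner v u = (inner u v)^*%R.
Proof. by rewrite (hermC inner) /= expr0 mul1r. Qed.

Lemma inner_rank_one (R : realType) (H : hilbert R) (e u : H) :
  inner (rank_one e u) u = `|inner u e| ^+ 2.
Proof. by rewrite /= linearZl_LR /= (inner_conj _ _ u e) normCK. Qed.

Section HiddenBasis.
Variables (R : realType) (H : hilbert R) (D : choiceType) (eH : D -> H).
Hypothesis heH : orthonormal_basis eH.

Lemma rank_one_basis (i j : D) : rank_one (eH i) (eH j) = (j == i)%:R *: eH i.
Proof. by rewrite /= (proj1 heH). Qed.

(** [rank_one (eH j)] is continuous, so it applies to the expansion of [w u] term by term, and only
    the term at [j] survives. *)
Lemma inner_diagonal_bop (p : D -> R[i]) (w : bop H) (j : D) (u : H) :
  has_sum (fun i => p i *: rank_one (eH i) u) (w u) ->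
  inner (w u) (eH j) = p j * inner u (eH j).
Proof.
move=> /(has_sum_bop _ _ (rank_one (eH j))) wu.
set x := (_ \o _) in wu.
have xE i : x i = (p i * inner u (eH i)) *: ((i == j)%:R *: eH j).
  by rewrite /x [LHS]bopZE /= linearZl_LR /= (proj1 heH) !scalerA mulrA.
have x0 i : i != j -> x i = 0.
  by rewrite xE => /negbTE ->; rewrite scale0r scaler0.
have := has_sum_unique _ _ _ _ _ _ wu (has_sum_supp1 _ _ _ _ _ x0).
rewrite xE eqxx scale1r /= => /(congr1 (fun v => inner v (eH j))).
by rewrite !linearZl_LR /= (proj1 heH) eqxx !mulr1.
Qed.

Section Transition.
Variables (HH : hilbert_tensor H H) (s : D -> D -> R[i]) (K Kstar : bop HH).
Hypothesis hK : forall x : HH, has_sum (fun jk : D * D =>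
  s jk.1 jk.2 *: top (rank_one (eH jk.1)) (rank_one (eH jk.2)) x) (K x).
Hypothesis hKstar : is_adjoint K Kstar.

Lemma diagonal_tensor_bop (j k : D) :
  K (tmul (eH j) (eH k)) = s j k *: tmul (eH j) (eH k).
Proof.
set x := fun jk : D * D => s jk.1 jk.2 *:
  (top (rank_one (eH jk.1)) (rank_one (eH jk.2)) : bop HH)
    (tmul (eH j) (eH k)).
have xE jk : x jk = s jk.1 jk.2 *:
    ((j == jk.1)%:R *: ((k == jk.2)%:R *: tmul (eH jk.1) (eH jk.2))).
  by rewrite /x top_tmul !rank_one_basis linearZl_LR linearZr_LR.
have x0 jk : jk != (j, k) -> x jk = 0.
  case: jk => j' k'; rewrite xE xpair_eqE /= negb_and.
  rewrite !(eq_sym _ j) !(eq_sym _ k).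
  by case/orP => /negbTE ->; rewrite scale0r ?scaler0.
rewrite (has_sum_unique _ _ _ _ _ _ (hK _) (has_sum_supp1 _ _ _ _ _ x0)).
by rewrite xE /= !eqxx !scale1r.
Qed.

(** The partial trace is computed in [eH] itself. Moving [Kstar] across the inner product puts [K]
    on both vectors, where it contributes [s j k] and its conjugate; only the modulus remains,
    whatever the phase. *)
Lemma transition_expectation (E : bop HH -> bop H) (a b : bop H) (j : D) :
  (forall x, is_ptrace2 (Kstar * x * K) (E x)) ->
  has_sum ((fun k => inner (a (eH j)) (eH j) * `|s j k| ^+ 2 *
    inner (b (eH k)) (eH k)) : D -> R[i]^o) (inner (E (top a b) (eH j)) (eH j)).
Proof.
move=> /(_ (top a b) _ _ heH (eH j) (eH j)); apply: eq_has_sum => k.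
transitivity (inner ((top a b : bop HH) (K (tmul (eH j) (eH k))))
                    (K (tmul (eH j) (eH k)))).
  by rewrite inner_conj -hKstar -inner_conj.
rewrite diagonal_tensor_bop bopZE linearZl_LR /= inner_conj linearZl_LR /=.
rewrite rmorphM /= -inner_conj top_tmul inner_tmul normCK.
by rewrite mulrA [RHS]mulrAC [RHS]mulrC.
Qed.

End Transition.
End HiddenBasis.

(** * Linear spans *)

Section LinearSpan.
Variables (K : pzRingType) (V : lmodType K).
Implicit Types (S P : set V).

Lemma lin_span_ind S P :
  P 0 -> (forall c x y, P x -> P y -> P (c *: x + y)) -> S `<=` P ->
  lin_span S `<=` P.
Proof.
move=> P0 Pl SP _ [n [c [v [Sv ->]]]].
elim: n c v Sv => [|n IHn] c v Sv; first by rewrite big_ord0.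
rewrite big_ord_recl; apply: Pl; first exact/SP/Sv.
by apply: IHn => i; exact: Sv.
Qed.

Lemma lin_span0 S : lin_span S 0.
Proof.
by exists 0%N, (fun=> 0), (fun=> 0); split; [case | rewrite big_ord0].
Qed.

Lemma sub_lin_span S : S `<=` lin_span S.
Proof.
move=> x Sx; exists 1%N, (fun=> 1), (fun=> x).
by rewrite big_ord1 scale1r.
Qed.

Lemma lin_span_linear S c x y :
  lin_span S x -> lin_span S y -> lin_span S (c *: x + y).
Proof.
move=> [m [a [u [Su ->]]]] [n [b [v [Sv ->]]]].
exists (m + n)%N, (fun i : 'I_(m + n) =>
    match fintype.split i with inl j => c * a j | inr j => b j end),
  (fun i : 'I_(m + n) =>
    match fintype.split i with inl j => u j | inr j => v j end).
split=> [i|]; first by case: (fintype.split i).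
rewrite big_split_ord scaler_sumr; congr (_ + _); apply: eq_bigr => i _.
  by rewrite (unsplitK (inl i)) scalerA.
by rewrite (unsplitK (inr i)).
Qed.

End LinearSpan.

Lemma lin_spanM (K : comPzRingType) (V : algType K) (S S' T : set V) (x y : V) :
  (forall u v, S u -> S' v -> T (u * v)) ->
  lin_span S x -> lin_span S' y -> lin_span T (x * y).
Proof.
move=> ST Sx Sy; move: x Sx; apply: lin_span_ind.
- by rewrite mul0r; exact: lin_span0.
- by move=> c u v Tu Tv; rewrite mulrDl -scalerAl; exact: lin_span_linear.
move=> u Su; move: y Sy; apply: lin_span_ind.
- by rewrite mulr0; exact: lin_span0.
- by move=> c v w Tv Tw; rewrite mulrDr -scalerAr; exact: lin_span_linear.
by move=> v Sv; apply/sub_lin_span/ST.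
Qed.

(** * Products of projections span the diagonal algebra *)

Section DiagonalAlgebra.
Variables (R : realType) (H : hilbert R) (D : choiceType).
Variables (A : tensor_chain H) (eO : nat -> D -> H).

Definition elementary_projections (n : nat) : set A :=
  [set x | exists k : nat -> D,
    x = \prod_(0 <= m < n.+1) emb m (rank_one (eO m (k m)))].

Lemma diag_factor_emb (n : nat) (a : bop H) : diag_factor (eO n) a ->
  lin_span (range (fun j => emb n (rank_one (eO n j)) : A)) (emb n a).
Proof.
have [embL _] := emb_morphism A n; move: a.
apply: lin_span_ind => [|c a b Sa Sb|_ [j _ <-]].
- have := embL (-1) 0 0; rewrite scaleN1r addNr scaleN1r addNr => ->.
  exact: lin_span0.
- by rewrite embL; exact: lin_span_linear.
by apply: sub_lin_span; exists j.
Qed.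

Lemma lin_span_elementary_projections (n : nat) (a : nat -> bop H) :
  (forall m, (m <= n)%N -> diag_factor (eO m) (a m)) ->
  lin_span (elementary_projections n) (\prod_(0 <= m < n.+1) emb m (a m) : A).
Proof.
elim: n => [|n IHn] ha.
  rewrite big_nat1; have := diag_factor_emb _ _ (ha 0%N isT).
  apply: lin_span_ind; [exact: lin_span0|exact: lin_span_linear|].
  by move=> _ [j _ <-]; apply: sub_lin_span; exists (fun=> j); rewrite big_nat1.
rewrite big_nat_recr //=.
apply: lin_spanM (IHn _) (diag_factor_emb _ _ (ha n.+1 _)) => //; last first.
  by move=> m mn; apply: ha; rewrite leqW.
(* The longer product follows [k] up to [n] and takes the new index [j] at [n.+1]. *)
move=> _ _ [k ->] [j _ <-]; exists (fun m => if (m <= n)%N then k m else j).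
rewrite [RHS]big_nat_recr //= ltnn; congr (_ * _).
by apply: eq_big_nat => m /andP[_]; rewrite ltnS => ->.
Qed.

Lemma elementary_projections_diag (n : nat) :
  elementary_projections n `<=` diag_algebra eO.
Proof.
move=> _ [k ->]; apply: sub_lin_span; exists n.
exists (fun m => rank_one (eO m (k m))).
by split=> // m _; apply: sub_lin_span; exists (k m).
Qed.

(** Elementary tensors expand into products of projections, so agreement on those propagates by
    linearity. As linearity is assumed only inside the diagonal algebra, the span inductions carry
    membership along with equality. *)
Lemma diag_algebra_ext (phi psi : A -> R[i]) :
  (forall c x y, diag_algebra eO x -> diag_algebra eO y ->
     phi (c *: x + y) = c * phi x + phi y) ->
  (forall c x y, diag_algebra eO x -> diag_algebra eO y ->
     psi (c *: x + y) = c * psi x + psi y) ->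
  (forall n x, elementary_projections n x -> psi x = phi x) ->
  forall x, diag_algebra eO x -> psi x = phi x.
Proof.
have lin0 (f : A -> R[i]) : (forall c x y, diag_algebra eO x ->
    diag_algebra eO y -> f (c *: x + y) = c * f x + f y) -> f 0 = 0.
  move=> /(_ (-1) 0 0 (lin_span0 _ _ _) (lin_span0 _ _ _)).
  by rewrite scaleN1r addNr mulN1r addNr.
move=> phiL psiL eqT.
pose P := [set x : A | diag_algebra eO x /\ psi x = phi x].
suff : diag_algebra eO `<=` P by move=> sub x /sub[].
have P0 : P 0 by split; [exact: lin_span0 | rewrite !lin0].
have PL c x y : P x -> P y -> P (c *: x + y).
  move=> [Dx Ex] [Dy Ey]; split; first exact: lin_span_linear.
  by rewrite psiL // phiL // Ex Ey.
apply: lin_span_ind => // _ [n [a [ha ->]]].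
move: (lin_span_elementary_projections n a ha); apply: lin_span_ind => // x Tx.
by split; [exact: elementary_projections_diag Tx | exact: eqT Tx].
Qed.

End DiagonalAlgebra.

Theorem theorem11 (R : realType) (H : hilbert R) (D : countType)
    (eH : D -> H) (heH : orthonormal_basis eH)
    (HH : hilbert_tensor H H) (A : tensor_chain H)
    (p0 : D -> R) (w0 : bop H)
    (hw0 : forall u, has_sum (fun j => (p0 j)%:C *: rank_one (eH j) u) (w0 u))
    (hw0_density : is_density w0) (hw0_spec : nondegenerate_spectrum w0)
    (phi0 : bop H -> R[i]) (hphi0 : forall a, is_trace (w0 * a) (phi0 a))
    (pH : D -> D -> R) (hpH : stochastic pH)
    (s : D -> D -> R[i]) (hs : forall j k, s j k ^+ 2 = (pH j k)%:C)
    (K Kstar : bop HH)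
    (hK : forall x : HH,
      has_sum (fun jk : D * D =>
        s jk.1 jk.2 *: top (rank_one (eH jk.1)) (rank_one (eH jk.2)) x) (K x))
    (hKstar : is_adjoint K Kstar)
    (E : bop HH -> bop H) (hE : forall x, is_ptrace2 (Kstar * x * K) (E x))
    (phi : A -> R[i]) (hphi : is_qmc phi0 E phi)
    (eO : nat -> D -> H) (heO : forall n, orthonormal_basis (eO n)) :
  has_joint_probabilities p0 pH eH eO phi /\
  (forall psi : A -> R[i],
     (forall (c : R[i]) (x y : A),
        diag_algebra eO x -> diag_algebra eO y ->
        psi (c *: x + y) = c * psi x + psi y) ->
     has_joint_probabilities p0 pH eH eO psi ->
     forall x : A, diag_algebra eO x -> psi x = phi x).
Proof.
(* [p0 j] is the diagonal entry of the positive operator [w0] at [eH j]. *)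
have p0_ge0 j : 0 <= (p0 j)%:C.
  have := hw0_density.1 (eH j).
  by rewrite (inner_diagonal_bop _ _ _ _ heH _ _ _ _ (hw0 _)) heH.1 eqxx mulr1.
have sE j k : `|s j k| ^+ 2 = (pH j k)%:C.
  by rewrite -normrX hs ger0_norm // lecR (hpH.1 j k).
have [[phiL _ _] phiE] := hphi.
have joint : has_joint_probabilities p0 pH eH eO phi.
  move=> n k; pose a m := rank_one (eO m (k m)); rewrite (phiE n a).
  (* [X m] is the nested expectation from site [m] inwards: [X 0] is the full argument of [phi0],
     and [X n.+1] is the unit. *)
  pose X m := foldr (fun m x => E (top (a m) x)) 1 (iota m (n.+1 - m)).
  pose t m j := inner (X m (eH j)) (eH j).
  pose e m j : R[i] := emission eH (eO m) j (k m).
  have XS m : (m <= n)%N -> X m = E (top (a m) (X m.+1)).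
    by move=> mn; rewrite /X subSS subSn.
  have tS m j : (m <= n)%N -> has_sum
      ((fun i => e m j * (pH j i)%:C * t m.+1 i) : D -> R[i]^o) (t m j).
    move=> mn; rewrite /t (XS m mn).
    apply: eq_has_sum
      (transition_expectation _ _ _ _ heH _ _ _ _ hK hKstar _ _ _ _ hE) => i.
    by rewrite inner_rank_one sE.
  (* At [m = n] the recursion meets the unit, whose diagonal entries are all 1, so the row sum of
     [pH] collapses to 1 and only the emission probability is left. *)
  have tn : t n =1 e n.
    move=> j; apply: has_sum_unique (tS n j (leqnn n)) _.
    have := has_sum_real_complex _ _ _ _ (hpH.2 j).
    move=> /(has_sumZ _ _ (e n j)); rewrite mulr1; apply: eq_has_sum => i.
    by rewrite /t /X subnn /= heH.1 eqxx mulr1.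
  (* The trace defining [phi0] is taken in [eH], where [w0] multiplies the diagonal entries by
     [p0]. *)
  have t0 : has_sum ((fun j => (p0 j)%:C * t 0%N j) : D -> R[i]^o)
      (phi0 (X 0%N)).
    apply: eq_has_sum (hphi0 (X 0%N) _ _ heH) => j.
    by rewrite (inner_diagonal_bop _ _ _ _ heH _ _ _ _ (hw0 _)).
  have p_ge0 i j : 0 <= (pH i j)%:C by rewrite lecR (hpH.1 i j).
  have e_ge0 m j : 0 <= e m j by rewrite exprn_ge0.
  apply: eq_has_sum (has_sum_path_weight _ _ _ _ _ _ _ _ p_ge0 e_ge0 p0_ge0
    (fun m j mn => tS m j (ltnW mn)) tn t0) => f.
  by rewrite rmorphM rmorph_prod /path_weight mulrA.
split=> // psi psiL psiE; apply: diag_algebra_ext => //.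
  by move=> c x y _ _; exact: phiL.
(* Both values are sums of the same family over hidden paths. *)
by move=> n _ [k ->]; exact: has_sum_unique (psiE n k) (joint n k).
Qed.
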